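(* Let $p$ be a prime, let $P_1,P_2$ be finite $p$-groups with a common subgroup $A$ such that $A\trianglelefteq P_i$ for $i=1,2$, and let $\Omega$ be the subgroup of $\operatorname{Aut}(A)$ generated by the conjugation actions of $P_1$ and $P_2$ on $A$ (i.e. by the images of the two homomorphisms $P_i\to\operatorname{Aut}(A)$ given by conjugation). Then $(P_1,A,P_2)$ has a strong finite $p$-envelope if and only if $\Omega$ is a $p$-group.
   Context: An amalgam $(P_1,A,P_2)$ of finite $p$-groups has a strong finite $p$-envelope if there are a finite $p$-group $E$ and embeddings $\iota_i:P_i\hookrightarrow E$ ($i=1,2$) which agree on $A$ and satisfy $\iota_1(P_1)\cap\iota_2(P_2)=\iota_1(A)$. *)

(* Defs.v *)
From HB Require Import structures.
From mathcomp Require Import all_boot all_fingroup all_solvable.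

Set Implicit Arguments.
Unset Strict Implicit.
Unset Printing Implicit Defensive.

Local Open Scope group_scope.

(* An amalgam (P1, A, P2) is given by groups P1 : {group gT1} and             *)
(* P2 : {group gT2} over possibly different finGroupTypes, together with an   *)
(* abstract group A : {group aT} and injective morphisms j1, j2 from A into   *)
(* P1 and P2: the common subgroup is j1 @* A inside P1 and j2 @* A inside P2, *)
(* an element a of A being identified with both j1 a and j2 a.                *)

Definition has_strong_envelope (p : nat) (aT gT1 gT2 : finGroupType)
    (A : {group aT}) (P1 : {group gT1}) (P2 : {group gT2})
    (j1 : {morphism A >-> gT1}) (j2 : {morphism A >-> gT2}) : Prop :=
  exists (eT : finGroupType) (E : {group eT})
         (i1 : {morphism P1 >-> eT}) (i2 : {morphism P2 >-> eT}),
    p.-group E /\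
    ('injm i1 /\ i1 @* P1 \subset E) /\
    ('injm i2 /\ i2 @* P2 \subset E) /\
    {in A, forall a, i1 (j1 a) = i2 (j2 a)} /\
    i1 @* P1 :&: i2 @* P2 = i1 @* (j1 @* A).

Section ConjugationOnSubgroup.

Variables (aT gT : finGroupType) (A : {group aT}) (j : {morphism A >-> gT}).
Hypothesis injj : 'injm j.

(* The homomorphism 'N(j @* A) -> Aut A given by conjugation: conj_aut takes  *)
(* values in Aut (j @* A), which is then identified with Aut A along j.       *)
Definition conj_on (x : gT) : {perm aT} :=
  (invm (injm_Aut_isom injj (subxx A)) \o conj_aut (j @* A)%G) x.

Canonical conj_on_morphism := Eval hnf in [morphism of conj_on].

Lemma dom_conj_on : 'dom conj_on = 'N(j @* A).
Proof.
rewrite /dom /=; apply/setP=> x; rewrite inE.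
case Nx: (x \in 'N(j @* A)) => //=.
by rewrite inE im_Aut_isom Aut_aut.
Qed.

Lemma conj_on_Aut x : x \in 'N(j @* A) -> conj_on x \in Aut A.
Proof.
move=> Nx; have/setP/(_ (conj_on x)) <- :=
  im_invm (injm_Aut_isom injj (subxx A)).
by apply: mem_morphim; rewrite /= im_Aut_isom Aut_aut.
Qed.

Lemma conj_onE : {in 'N(j @* A) & A, forall x a, j (conj_on x a) = j a ^ x}.
Proof.
move=> x a Nx Aa; rewrite -(Aut_isomE injj (subxx A) (conj_on_Aut Nx) Aa).
rewrite /conj_on /= invmK ?norm_conj_autE ?mem_morphim //.
by rewrite im_Aut_isom Aut_aut.
Qed.

End ConjugationOnSubgroup.

Definition conj_Omega (aT gT1 gT2 : finGroupType)
    (A : {group aT}) (P1 : {group gT1}) (P2 : {group gT2})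
    (j1 : {morphism A >-> gT1}) (j2 : {morphism A >-> gT2})
    (inj1 : 'injm j1) (inj2 : 'injm j2) : {set {perm aT}} :=
  (conj_on inj1 @* P1) <*> (conj_on inj2 @* P2).

(* Main.v *)
Require Import Defs.
From HB Require Import structures.
From mathcomp Require Import all_boot all_fingroup all_solvable.

Set Implicit Arguments.
Unset Strict Implicit.
Unset Printing Implicit Defensive.

Local Open Scope group_scope.

(** In an envelope E, both P1 and P2 normalise the common image of A, so Omega
    is a homomorphic image of a subgroup of the normaliser of that image in E,
    hence a p-group ([envelope_Omega_pgroup]).

    Conversely, let Q_i = P_i / A. The envelope is a permutational product:
    after choosing coset representatives, Q_i x A is identified with P_i by
    (q, b) |-> rep q * b, and the right regular action of P_i becomes an action
    on A x Q_i in which A acts by right translations of the first factor alone.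
    Letting P_i act trivially on the other quotient, both groups act faithfully
    on A x Q_1 x Q_2, and the two actions coincide on A. An element in both
    images acts trivially on Q_1 x Q_2, so it comes from A.

    It remains to find a p-group that contains both images. The element x moves
    the fibre A over q to the fibre over q * x by
    b |-> s'^-1 s b x = (b ^ n) * (n^-1 x),  where s = rep q, s' = rep (q * x)
    and n = s^-1 s'. Since n lies in the coset of x, this is an element of Omega
    followed by a translation by an element of A ([fibre_in_holo]). So both
    images lie in the wreath product of the holomorph-like group A Omega by
    Q_1 x Q_2, and that wreath product is a p-group as soon as A, Omega, Q_1 and
    Q_2 are ([holo_pgroup], [wreath_pgroup]). *)

(** * Wreath products as groups of permutations *)

Section Wreath.

Variables (T : finType) (Q : finGroupType).
Implicit Types (f : Q -> {perm T}) (g : Q) (H : {group {perm T}}) (G : {group Q}).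

Definition skew_fun f g (u : T * Q) : T * Q := (f u.2 u.1, u.2 * g).

Lemma skew_fun_inj f g : injective (skew_fun f g).
Proof.
by move=> [b q] [b' q'] [/= fbb' /mulIg eqq]; move: fbb'; rewrite eqq => /perm_inj->.
Qed.

Definition skew f g : {perm T * Q} := perm (@skew_fun_inj f g).

Lemma skewE f g b q : skew f g (b, q) = (f q b, q * g).
Proof. by rewrite permE. Qed.

Lemma eq_skew f f' g : f =1 f' -> skew f g = skew f' g.
Proof. by move=> eqf; apply/permP=> -[b q]; rewrite !skewE eqf. Qed.

Lemma skewM f g f' g' :
  skew f g * skew f' g' = skew (fun q => f q * f' (q * g)) (g * g').
Proof. by apply/permP=> -[b q]; rewrite permM !skewE permM mulgA. Qed.

Lemma skew1 : skew (fun=> 1) 1 = 1.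
Proof. by apply/permP=> -[b q]; rewrite skewE !perm1 mulg1. Qed.

(** The imprimitive action on [T * Q] of the wreath product of [H] by [G]; all
    of [Q], and not only [G], indexes the fibres, which spares a subtype. *)
Definition wreath (H : {set {perm T}}) (G : {set Q}) : {set {perm T * Q}} :=
  [set skew u.1 u.2 | u : {ffun Q -> {perm T}} * Q
                    in setX [set f | f \in ffun_on H] G].

Lemma mem_wreath (H : {set {perm T}}) (G : {set Q}) f g :
  (forall q, f q \in H) -> g \in G -> skew f g \in wreath H G.
Proof.
move=> Hf Gg; apply/imsetP; exists (finfun f, g) => /=.
  by rewrite inE /= Gg andbT inE; apply/ffun_onP=> q; rewrite ffunE.
by apply: eq_skew => q; rewrite ffunE.
Qed.

Lemma wreathP (H : {set {perm T}}) (G : {set Q}) w :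
  reflect (exists f g, [/\ forall q, f q \in H, g \in G & w = skew f g])
          (w \in wreath H G).
Proof.
apply: (iffP imsetP) => [[[f g]] | [f [g [Hf Gg ->]]]].
  rewrite inE /= inE => /andP[/ffun_onP Hf Gg] ->.
  by exists (f : Q -> {perm T}), g; split.
by apply/imsetP; apply: mem_wreath.
Qed.

Lemma wreath_group_set H G : group_set (wreath H G).
Proof.
apply/group_setP; split=> [|w w'].
  by rewrite -skew1; apply: mem_wreath.
case/wreathP=> f [g [Hf Gg ->]] /wreathP[f' [g' [Hf' Gg' ->]]].
by rewrite skewM; apply: mem_wreath => [q|]; rewrite groupM.
Qed.

Canonical wreath_group H G := Group (wreath_group_set H G).

(** A permutation in the wreath product determines its fibre maps and its shift
    when [T] is inhabited, so the order is [#|H| ^ #|Q| * #|G|]. *)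
Lemma wreath_pgroup (p : nat) H G :
  p.-group H -> p.-group G -> p.-group (wreath H G).
Proof.
move=> pH pG; rewrite /pgroup.
have [t0 | T0] := pickP T; last first.
  suff ->: wreath H G = 1 by rewrite cards1.
  apply/trivgP/subsetP=> w _; rewrite inE; apply/eqP/permP=> -[b q].
  by have:= T0 b.
rewrite card_in_imset => [|[f g] [f' g'] _ _ /= eq_w].
  by rewrite cardsX cardsE card_ffun_on pnatM pnatX [_.-nat #|H|]pH [_.-nat #|G|]pG.
have eqw b q := congr1 (fun w : {perm T * Q} => w (b, q)) eq_w.
congr (_, _).
  by apply/ffunP=> q; apply/permP=> b; case: (eqw b q); rewrite !skewE => -[].
by have:= eqw t0 1; rewrite !skewE => -[_]; rewrite !mul1g.
Qed.

End Wreath.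

(** * Translations and automorphisms of a subgroup *)

Section Holomorph.

Variables (aT : finGroupType) (A : {group aT}).

Lemma rtrans_cond : actby_cond A A ('R : {action aT &-> aT}).
Proof. by apply/actsP=> a Aa b /=; rewrite groupMr. Qed.

(** Translations are made trivial outside [A], as the elements of [Aut A] are,
    so that [rtransJ] holds for permutations of the whole type. *)
Definition rtrans : aT -> {perm aT} := actperm <[rtrans_cond]>.

Canonical rtrans_morphism := Eval hnf in [morphism of rtrans].

Lemma rtransE : {in A & A, forall a b, rtrans a b = b * a}.
Proof. by move=> a b Aa Ab; rewrite actpermE actbyE. Qed.

Lemma rtrans_out a b : b \notin A -> rtrans a b = b.
Proof. by move=> nAb; rewrite actpermE /= /actby (negPf nAb). Qed.

Lemma Aut_stable f b : f \in Aut A -> (f b \in A) = (b \in A).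
Proof.
move=> Af; apply/idP/idP=> [Afb|]; last exact: Aut_closed.
by apply: contraLR Afb => nAb; rewrite (out_Aut Af).
Qed.

Lemma rtransJ : {in A & Aut A, forall a f, rtrans a ^ f = rtrans (f a)}.
Proof.
move=> a f Aa Af; apply/permP=> fb.
have [b ->]: exists b, fb = f b by exists (f^-1 fb); rewrite permKV.
have Afa: f a \in A by rewrite Aut_stable.
rewrite permJ; have [Ab | nAb] := boolP (b \in A).
  have Afb: f b \in A by rewrite Aut_stable.
  by rewrite !rtransE // (morphicP (Aut_morphic Af)).
by rewrite !rtrans_out // Aut_stable.
Qed.

(** With [O] the whole of [Aut A], this is the holomorph of [A]. *)
Definition holo (O : {set {perm aT}}) := O <*> (rtrans @* A).

(** Automorphisms normalise the translation group, so the join is a product. *)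
Lemma holo_pgroup p (O : {group {perm aT}}) :
  O \subset Aut A -> p.-group A -> p.-group O -> p.-group (holo O).
Proof.
move=> OA pA pO; rewrite /holo norm_joinEl ?pgroupM ?pO ?morphim_pgroup //.
apply/normsP=> f /(subsetP OA) Af; apply/eqP.
rewrite eqEcard cardJg leqnn andbT; apply/subsetP=> _ /imsetP[_ /morphimP[a _ Aa ->] ->].
by rewrite rtransJ // mem_morphim ?Aut_stable.
Qed.

End Holomorph.

(** * The regular action read in fibres over the quotient *)

Lemma mem_conj_on (aT gT : finGroupType) (A : {group aT}) (P : {set gT})
    (j : {morphism A >-> gT}) (injj : 'injm j) x :
  x \in 'N(j @* A) -> x \in P -> conj_on injj x \in conj_on injj @* P.
Proof.
move=> Nx; have Dx: x \in 'dom (conj_on injj) by rewrite dom_conj_on.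
exact: mem_morphim.
Qed.

Section RegularFibres.

Variables (aT gT : finGroupType) (A : {group aT}) (P : {group gT}).
Variables (j : {morphism A >-> gT}) (injj : 'injm j).
Hypothesis nsBP : j @* A <| P.
Local Notation B := (j @* A).

Let sBP : B \subset P. Proof. exact: normal_sub. Qed.
Let nBP : P \subset 'N(B). Proof. exact: normal_norm. Qed.

Definition rep (q : coset_of B) : gT := repr q.

Lemma rep_norm q : rep q \in 'N(B).
Proof. exact: (repr_coset_norm (H := (j @* A)%G)). Qed.

Lemma repK q : coset B (rep q) = q.
Proof. exact: coset_reprK. Qed.

(** The automorphism part of the map between the fibres over [q] and over
    [q * coset B x] is conjugation by this element, which lies in the coset of
    [x] and hence in [P], although [q] need not be in [P / B]. *)
Definition shift (x : gT) (q : coset_of B) : gT :=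
  (rep q)^-1 * rep (q * coset B x).

(** The map [b |-> s'^-1 * s * b * x] of the regular action, with [s] and [s']
    the representatives of [q] and [q * coset B x] (see [fibreE]); it is written
    as an automorphism followed by a translation to make it a permutation of the
    whole type and to place it in [holo]. *)
Definition fibre (x : gT) (q : coset_of B) : {perm aT} :=
  conj_on injj (shift x q) * rtrans A (invm injj ((shift x q)^-1 * x)).

Lemma shift_mem x q : x \in P -> (shift x q)^-1 * x \in B.
Proof.
move=> Px; have Nx := subsetP nBP x Px.
apply: coset_idr => [|]; first by rewrite !groupM ?groupV ?groupM ?groupV ?rep_norm.
rewrite /shift !(morphM, morphV) ?groupV ?groupM ?groupV ?rep_norm //.
by rewrite /= !repK mulKg mulVg.
Qed.

Lemma shift_in x q : x \in P -> shift x q \in P.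
Proof.
move=> Px; have /(subsetP sBP) := shift_mem q Px.
by rewrite groupMr // groupV.
Qed.

Lemma invm_mem y : y \in B -> invm injj y \in A.
Proof.
move=> By; have /setP/(_ (invm injj y)) <- := im_invm injj.
exact: mem_morphim.
Qed.

Lemma fibre_in_holo x q (O : {set {perm aT}}) :
  conj_on injj @* P \subset O -> x \in P -> fibre x q \in holo A O.
Proof.
move=> sPO Px; have Ps := shift_in q Px; have Bs := shift_mem q Px.
rewrite groupM //.
  rewrite mem_gen // inE (subsetP sPO) //.
  by rewrite mem_conj_on ?(subsetP nBP).
by rewrite mem_gen // inE orbC mem_morphim ?invm_mem.
Qed.

Lemma conj_on_P_Aut x : x \in P -> conj_on injj x \in Aut A.
Proof. by move=> Px; rewrite conj_on_Aut ?(subsetP nBP). Qed.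

Lemma fibre_stable x q b : x \in P -> b \in A -> fibre x q b \in A.
Proof.
move=> Px Ab; have As := invm_mem (shift_mem q Px).
by rewrite permM rtransE ?groupM ?Aut_stable ?conj_on_P_Aut ?shift_in.
Qed.

Lemma fibre_out x q b : x \in P -> b \notin A -> fibre x q b = b.
Proof.
move=> Px nAb; rewrite permM (out_Aut (conj_on_P_Aut (shift_in q Px))) //.
exact: rtrans_out.
Qed.

(** This equation is the right regular action, under the bijection
    [(q, b) |-> rep q * j b]; it determines [fibre x q] on [A]. *)
Lemma fibreE x q b : x \in P -> b \in A ->
  rep (q * coset B x) * j (fibre x q b) = rep q * j b * x.
Proof.
move=> Px Ab; have Ps := shift_in q Px; have Bs := shift_mem q Px.
have As := invm_mem Bs; have Acb := Aut_closed (conj_on_P_Aut Ps) Ab.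
rewrite permM rtransE // morphM // conj_onE ?(subsetP nBP) // invmK //.
by rewrite conjgE /shift !invMg invgK !mulgA mulgV mul1g !mulgK mulgKV.
Qed.

(** Associativity of the regular action, read in the fibres. *)
Lemma fibreM : {in P &, forall x y q,
  fibre (x * y) q = fibre x q * fibre y (q * coset B x)}.
Proof.
move=> x y Px Py q; have Pxy := groupM Px Py; apply/permP=> b; rewrite permM.
have [Ab | nAb] := boolP (b \in A); last by rewrite !fibre_out.
have Axb := fibre_stable q Px Ab.
apply: (injmP injj); rewrite ?fibre_stable //.
apply: (mulgI (rep (q * coset B (x * y)))); rewrite fibreE //.
rewrite morphM ?(subsetP nBP) // [q * (_ * _)]mulgA fibreE // fibreE //.
by rewrite !mulgA.
Qed.

(** The translation obtained depends neither on [q] nor on the embedding [j]: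
    this is why the two regular actions agree on [A]. *)
Lemma fibre_base a q : a \in A -> fibre (j a) q = rtrans A a.
Proof.
move=> Aa; have Ba: j a \in B by rewrite mem_morphim.
have Pa := subsetP sBP _ Ba; apply/permP=> b.
have [Ab | nAb] := boolP (b \in A); last by rewrite fibre_out ?rtrans_out.
rewrite rtransE //; apply: (injmP injj); rewrite ?fibre_stable ?groupM //.
apply: (mulgI (rep q)); rewrite -{1}[q]mulg1 -(coset_id Ba) fibreE //.
by rewrite morphM // mulgA.
Qed.

(** [Q] will be the product of two quotients, and [coset_of B] a factor of it
    with projection [pr] and inclusion [inc]. *)
Variables (Q : finGroupType) (pr : Q -> coset_of B) (inc : coset_of B -> Q).
Hypothesis prM : forall q r, pr (q * inc r) = pr q * r.
Hypothesis incM : {morph inc : r r' / r * r'}.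
Hypothesis inc_inj : injective inc.

Definition regular_embedding (x : gT) : {perm aT * Q} :=
  skew (fun q => fibre x (pr q)) (inc (coset B x)).

Lemma regular_embeddingM :
  {in P &, {morph regular_embedding : x y / x * y}}.
Proof.
move=> x y Px Py; rewrite /regular_embedding skewM.
rewrite morphM ?(subsetP nBP) // incM.
by apply: eq_skew => q; rewrite prM fibreM.
Qed.

Definition regular_morphism := Morphism regular_embeddingM.

Lemma inc1 : inc 1 = 1.
Proof. by apply: (mulgI (inc 1)); rewrite -incM !mulg1. Qed.

Lemma regular_base a : a \in A ->
  regular_embedding (j a) = skew (fun=> rtrans A a) 1.
Proof.
move=> Aa; rewrite /regular_embedding coset_id ?mem_morphim // inc1.
by apply: eq_skew => q; apply: fibre_base.
Qed.

Lemma injm_regular : 'injm regular_morphism.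
Proof.
apply/subsetP=> x /morphpreP[/= Px /set1P rx1]; apply/set1P.
have rx u : regular_embedding x u = u by rewrite rx1 perm1.
have /coset_idr Bx: coset B x = 1.
  have := rx (1, 1); rewrite skewE => -[_]; rewrite mul1g -inc1.
  exact: inc_inj.
have /morphimP[a _ Aa def_x] := Bx (subsetP nBP x Px).
have := rx (1, 1); rewrite def_x regular_base // skewE rtransE // => -[].
by rewrite mul1g => ->; rewrite morph1.
Qed.

Lemma regular_in_wreath (O : {set {perm aT}}) (G : {set Q}) x :
  conj_on injj @* P \subset O -> inc (coset B x) \in G -> x \in P ->
  regular_embedding x \in wreath (holo A O) G.
Proof. by move=> sPO Gx Px; apply: mem_wreath => // q; apply: fibre_in_holo. Qed.

End RegularFibres.

(** * The two implications *)

(** Conjugation is preserved by the homomorphism [i], so the automorphism that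
    [x] induces on [A] can be computed in [eT]. *)
Lemma conj_on_comp (aT gT eT : finGroupType) (A : {group aT}) (P : {group gT})
    (j : {morphism A >-> gT}) (i : {morphism P >-> eT}) (k : {morphism A >-> eT})
    (injj : 'injm j) (injk : 'injm k) x :
    j @* A <| P -> {in A, forall a, k a = i (j a)} -> x \in P ->
  i x \in 'N(k @* A) /\ conj_on injj x = conj_on injk (i x).
Proof.
case/andP=> sBP nBP kE Px; have Nx := subsetP nBP x Px.
have Pj a: a \in A -> j a \in P.
  by move=> Aa; rewrite (subsetP sBP) ?mem_morphim.
have kJ a : a \in A -> k a ^ i x = k (conj_on injj x a).
  move=> Aa; rewrite !kE ?Aut_closed ?conj_on_Aut // conj_onE // morphJ //.
  exact: Pj.
have Nix: i x \in 'N(k @* A).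
  rewrite inE; apply/subsetP=> _ /imsetP[_ /morphimP[a _ Aa ->] ->].
  by rewrite kJ // mem_morphim // Aut_closed ?conj_on_Aut.
split=> //; have Ajx := conj_on_Aut injj Nx.
have Akx := conj_on_Aut injk Nix.
apply: (eq_Aut Ajx Akx) => a Aa.
by apply: (injmP injk); rewrite ?Aut_closed // -kJ // conj_onE.
Qed.

Lemma envelope_Omega_pgroup (p : nat) (aT gT1 gT2 : finGroupType)
    (A : {group aT}) (P1 : {group gT1}) (P2 : {group gT2})
    (j1 : {morphism A >-> gT1}) (j2 : {morphism A >-> gT2})
    (inj1 : 'injm j1) (inj2 : 'injm j2) :
  j1 @* A <| P1 -> j2 @* A <| P2 ->
  has_strong_envelope p P1 P2 j1 j2 -> p.-group (conj_Omega P1 P2 inj1 inj2).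
Proof.
move=> ns1 ns2 [eT [E [i1 [i2 [pE [[inji1 sE1] [[_ sE2] [eqA _]]]]]]]].
have Pj1 a: a \in A -> j1 a \in P1.
  by move=> Aa; rewrite (subsetP (normal_sub ns1)) ?mem_morphim.
have kM: {in A &, {morph (fun a => i1 (j1 a)) : a b / a * b}}.
  by move=> a b Aa Ab /=; rewrite !morphM ?Pj1.
pose k := Morphism kM.
have injk: 'injm k.
  apply/injmP=> a b Aa Ab /= eqab.
  by apply: (injmP inj1) => //; apply: (injmP inji1); rewrite ?Pj1.
apply: (pgroupS (G := (conj_on injk @* E)%G)); last exact: morphim_pgroup.
rewrite join_subG; apply/andP; split; apply/subsetP=> _ /morphimP[x _ Px ->] /=.
  have [//|Nx ->] := conj_on_comp inj1 (i := i1) injk ns1 _ Px.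
  by rewrite mem_conj_on // (subsetP sE1) ?mem_morphim.
have [//|Nx ->] := conj_on_comp inj2 (i := i2) injk ns2 _ Px.
by rewrite mem_conj_on // (subsetP sE2) ?mem_morphim.
Qed.

Lemma Omega_pgroup_envelope (p : nat) (aT gT1 gT2 : finGroupType)
    (A : {group aT}) (P1 : {group gT1}) (P2 : {group gT2})
    (j1 : {morphism A >-> gT1}) (j2 : {morphism A >-> gT2})
    (inj1 : 'injm j1) (inj2 : 'injm j2) :
  p.-group P1 -> p.-group P2 -> j1 @* A <| P1 -> j2 @* A <| P2 ->
  p.-group (conj_Omega P1 P2 inj1 inj2) -> has_strong_envelope p P1 P2 j1 j2.
Proof.
move=> pP1 pP2 ns1 ns2 pO.
have pA: p.-group A by rewrite -(injm_pgroup inj1) // (pgroupS (normal_sub ns1)).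
have [nB1 nB2] := (normal_norm ns1, normal_norm ns2).
pose B1 := j1 @* A; pose B2 := j2 @* A.
pose Q : finGroupType := (coset_of B1 * coset_of B2)%type.
pose O := (conj_Omega P1 P2 inj1 inj2).
have [sO1 sO2] : conj_on inj1 @* P1 \subset O /\ conj_on inj2 @* P2 \subset O.
  by split; [apply: joing_subl | apply: joing_subr].
have OA: O \subset Aut A.
  rewrite join_subG; apply/andP; split; apply/subsetP=> _ /morphimP[x _ Px ->].
    by rewrite conj_on_Aut ?(subsetP nB1).
  by rewrite conj_on_Aut ?(subsetP nB2).
pose inc1 (r : coset_of B1) : Q := (r, 1).
pose inc2 (r : coset_of B2) : Q := (1, r).
have pr1M (q : Q) r: (q * inc1 r).1 = q.1 * r by [].
have pr2M (q : Q) r: (q * inc2 r).2 = q.2 * r by [].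
have inc1M : {morph inc1 : r r' / r * r'}.
  by move=> r r'; congr (_, _); rewrite mulg1.
have inc2M : {morph inc2 : r r' / r * r'}.
  by move=> r r'; congr (_, _); rewrite mulg1.
have inc1I : injective inc1 by move=> r r' [].
have inc2I : injective inc2 by move=> r r' [].
pose i1 := regular_morphism inj1 ns1 pr1M inc1M.
pose i2 := regular_morphism inj2 ns2 pr2M inc2M.
pose G := (setX (P1 / B1) (P2 / B2))%G.
have pG: p.-group G.
  by rewrite /pgroup cardsX pnatM; apply/andP; split; apply: quotient_pgroup.
have agree: {in A, forall a, i1 (j1 a) = i2 (j2 a)}.
  move=> a Aa /=; rewrite (regular_base inj1 ns1 _ inc1M) //.
  by rewrite (regular_base inj2 ns2 _ inc2M).
exists _, (wreath_group (joing_group O (rtrans A @* A)) G), i1, i2.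
split; first by apply: wreath_pgroup => //; apply: holo_pgroup.
split.
  split; first exact: injm_regular.
  apply/subsetP=> _ /morphimP[x _ Px ->]; apply: (regular_in_wreath ns1) => //.
  by apply/setXP; rewrite /= mem_quotient ?group1.
split.
  split; first exact: injm_regular.
  apply/subsetP=> _ /morphimP[x _ Px ->]; apply: (regular_in_wreath ns2) => //.
  by apply/setXP; rewrite /= mem_quotient ?group1.
split=> //; apply/setP=> w; apply/setIP/idP=> [[/morphimP[x Nx Px ->]]|].
  case/morphimP=> y _ Py /= eqxy.
  (* The image of y fixes the coordinate in P1 / A, which x shifts. *)
  have := congr1 (fun w : {perm aT * Q} => (w (1, 1)).2.1) eqxy.
  rewrite !skewE /= !mul1g => /coset_idr Bx.
  by rewrite (mem_morphim i1) // Bx ?(subsetP nB1).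
case/morphimP=> _ _ /morphimP[a _ Aa ->] ->.
have [P1a P2a]: j1 a \in P1 /\ j2 a \in P2.
  by rewrite (subsetP (normal_sub ns1)) ?(subsetP (normal_sub ns2)) ?mem_morphim.
by split; [| rewrite agree //]; rewrite mem_morphim.
Qed.

Theorem theorem6p4 (p : nat) (aT gT1 gT2 : finGroupType)
    (A : {group aT}) (P1 : {group gT1}) (P2 : {group gT2})
    (j1 : {morphism A >-> gT1}) (j2 : {morphism A >-> gT2})
    (inj1 : 'injm j1) (inj2 : 'injm j2) :
  prime p -> p.-group P1 -> p.-group P2 ->
  j1 @* A <| P1 -> j2 @* A <| P2 ->
  has_strong_envelope p P1 P2 j1 j2 <-> p.-group (conj_Omega P1 P2 inj1 inj2).
Proof.
move=> _ pP1 pP2 ns1 ns2; split; first exact: envelope_Omega_pgroup.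
exact: Omega_pgroup_envelope.
Qed.
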